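(* Let $n\ge 1$. For every pure state $|\psi\rangle\in\mathcal H^{\otimes n}$, $$\Delta_{|\psi\rangle}(\hat H_{\mathrm{coll}})\;\le\; n^2\,\max_{1\le i\le n}\Delta_{|\psi\rangle}(\hat H_i).$$
   Context: $\mathcal H$ is a complex Hilbert space (finite or infinite-dimensional), $\hat H$ is a self-adjoint operator on $\mathcal H$ with non-degenerate spectrum. On $\mathcal H^{\otimes n}$, $\hat H_i=\mathbf 1^{\otimes(i-1)}\otimes\hat H\otimes\mathbf 1^{\otimes(n-i)}$ and $\hat H_{\mathrm{coll}}=\sum_{i=1}^n\hat H_i$. Pure states are unit vectors; $\Delta_{|\psi\rangle}(\hat A)=\langle\psi|\hat A^2|\psi\rangle-\langle\psi|\hat A|\psi\rangle^2$ denotes the variance (not its square root). If $\hat H$ is unbounded, only states lying in the domain of every $\hat H_i$ (so that all variances are finite) are considered. *)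

(* Defs.v *)
From HB Require Import structures.
From mathcomp Require Import all_boot all_order all_algebra.
From mathcomp Require Import all_classical all_reals all_analysis.
From mathcomp Require Import complex.

Set Implicit Arguments.
Unset Strict Implicit.
Unset Printing Implicit Defensive.

Import Order.TTheory GRing.Theory Num.Theory.
Import numFieldNormedType.Exports.

Local Open Scope classical_set_scope.
Local Open Scope ring_scope.

(* A complex Hilbert space: a complete normed space over R[i] whose norm comes
   from an inner product. The library's forms are linear in their first
   argument and antilinear in the second one. *)
HB.mixin Record isHilbert (R : realType) V
    of CompleteNormedModule R[i] V := {
  hdot : {dot V for (@Num.conj R[i])} ;
  hdot_norm : forall x : V, `|x| ^+ 2 = hdot x x }.

#[short(type="hilbertType")]
HB.structure Definition Hilbert (R : realType) :=
  { V of CompleteNormedModule R[i] V & isHilbert R V }.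

(* The physicists' <phi|psi>, antilinear in phi. *)
Definition braket (R : realType) (V : hilbertType R) (phi psi : V) : R[i] :=
  (hdot : {dot V for (@Num.conj R[i])}) psi phi.

Definition lin_span (R : realType) (V : lmodType R[i]) (S : set V) : set V :=
  [set v | exists m (c : 'I_m -> R[i]) (s : 'I_m -> V),
     (forall j, S (s j)) /\ v = \sum_(j < m) c j *: s j].

(* A possibly unbounded, partially defined operator is represented by its
   graph. *)
Definition operator (R : realType) (V : hilbertType R) := set (V * V).

Section Operators.
Variables (R : realType) (V : hilbertType R).
Implicit Types (A : operator V) (x psi : V).

Definition op_dom A : set V := [set x | exists y, A (x, y)].

(* The value A x when x is in the domain of A, and 0 otherwise. *)
Definition op_app A x : V := xget 0 [set y | A (x, y)].

Definition op_adjoint A : operator V :=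
  [set p | forall q, A q -> braket q.2 p.1 = braket q.1 p.2].

(* The density of the domain makes the adjoint single-valued, so that the
   equality of graphs forces A to be a closed linear operator. *)
Definition self_adjoint A : Prop := dense (op_dom A) /\ A = op_adjoint A.

(* Any two eigenvectors for the same eigenvalue are proportional. *)
Definition nondegenerate_spectrum A : Prop :=
  forall (lam : R[i]) (u v : V), u != 0 ->
    A (u, lam *: u) -> A (v, lam *: v) -> exists c : R[i], v = c *: u.

(* <psi|A^2|psi> - <psi|A|psi>^2, where <psi|A^2|psi> is read as
   <A psi|A psi>: for a symmetric A the two agree on the domain of A^2, and the
   latter is finite on the whole domain of A. The values at hand are real, and
   Re only sends them from R[i] to R. *)
Definition op_variance A psi : R :=
  complex.Re (braket (op_app A psi) (op_app A psi)
              - braket psi (op_app A psi) ^+ 2).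

(* The sum of operators, defined on the intersection of the domains. *)
Definition op_sum n (A : 'I_n -> operator V) : operator V :=
  [set p | exists y : 'I_n -> V,
     (forall i, A i (p.1, y i)) /\ p.2 = \sum_(i < n) y i].

End Operators.

(* (K, tau) is the n-th tensor power of the Hilbert space V, with
   tau x = x_0 (x) ... (x) x_(n-1). This determines (K, tau) up to a unique
   unitary. *)
Definition hilbert_tensor_power (R : realType) (V K : hilbertType R) n
    (tau : ('I_n -> V) -> K) : Prop :=
  [/\ forall (x : 'I_n -> V) (i : 'I_n),
        linear (fun u : V => tau (@dfwith 'I_n (fun=> V) x i u)),
      forall x y : 'I_n -> V,
        braket (tau x) (tau y) = \prod_(i < n) braket (x i) (y i)
    & dense (lin_span (range tau))].

Section LocalOperators.
Variables (R : realType) (V K : hilbertType R) (n : nat).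
Variables (tau : ('I_n -> V) -> K) (A : operator V).

(* 1 (x) ... (x) A (x) ... (x) 1, with A at position i: the closure of the
   operator sending a simple tensor tau x, with x_i in the domain of A, to the
   simple tensor in which x_i is replaced by A x_i. *)
Definition local_op (i : 'I_n) : operator K :=
  closure (lin_span
    [set p : K * K | exists (x : 'I_n -> V) (w : V),
       A (x i, w) /\ p = (tau x, tau (@dfwith 'I_n (fun=> V) x i w))]).

Definition collective_op : operator K := op_sum local_op.

End LocalOperators.

(* Main.v *)
(** For a symmetric operator A and a unit vector psi, the variance is
    |A psi - <psi|A psi> psi|^2. The centred vector of H_coll is the sum of the
    n centred vectors of the H_i, so the triangle inequality bounds its norm by
    n times the largest of theirs. The local operators being closures of
    graphs, one has to check that they are single-valued: they are symmetric,
    and the orthogonal complement of their domain is 0. *)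
Require Import Defs.
From mathcomp Require Import all_boot all_order all_algebra.
From mathcomp Require Import all_classical all_reals all_analysis.
From mathcomp Require Import complex ring.

Import Order.TTheory GRing.Theory Num.Theory.
Import numFieldNormedType.Exports.

Local Open Scope classical_set_scope.
Local Open Scope ring_scope.

(** * Sesquilinearity of the inner product and the Cauchy-Schwarz inequality *)

Section Braket.
Context {R : realType} {V : hilbertType R}.
Implicit Types x y z : V.

Lemma braket_norm x : braket x x = `|x| ^+ 2.
Proof. by rewrite /braket hdot_norm. Qed.

Lemma braketC x y : braket y x = (braket x y)^*%R.
Proof. by rewrite /braket hermC expr0 mul1r. Qed.

Lemma braketDr x y z : braket x (y + z) = braket x y + braket x z.
Proof. by rewrite /braket linearDl. Qed.

Lemma braketBr x y z : braket x (y - z) = braket x y - braket x z.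
Proof. by rewrite /braket linearBl. Qed.

Lemma braketZr a x y : braket x (a *: y) = a * braket x y.
Proof. by rewrite /braket linearZl_LR. Qed.

Lemma braket0r x : braket x 0 = 0.
Proof. by rewrite /braket linear0l. Qed.

Lemma braket_sumr I (r : seq I) (F : I -> V) x :
  braket x (\sum_(i <- r) F i) = \sum_(i <- r) braket x (F i).
Proof. by rewrite /braket linear_sumlz. Qed.

Lemma braketDl x y z : braket (x + y) z = braket x z + braket y z.
Proof. by rewrite braketC braketDr rmorphD/= -!braketC. Qed.

Lemma braket0l x : braket 0 x = 0.
Proof. by rewrite braketC braket0r rmorph0. Qed.

Lemma braketBl x y z : braket (x - y) z = braket x z - braket y z.
Proof. by rewrite braketC braketBr rmorphB/= -!braketC. Qed.

Lemma braketZl a x y : braket (a *: x) y = a^*%R * braket x y.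
Proof. by rewrite braketC braketZr rmorphM/= -braketC. Qed.

Lemma cauchy_schwarz x y : `|braket x y| <= `|x| * `|y|.
Proof.
have [->|y0] := eqVneq y 0; first by rewrite braket0r !normr0 mulr0.
set N := `|y| ^+ 2; set c := braket y x.
have N0 : 0 < N by rewrite exprn_gt0// normr_gt0.
(* The vector [N *: x - c *: y] is [N] times the component of [x] orthogonal to [y]; scaling by [N]
   avoids a division. *)
have: 0 <= N * (N * `|x| ^+ 2 - `|c| ^+ 2).
  have -> : N * (N * `|x| ^+ 2 - `|c| ^+ 2) = `|N *: x - c *: y| ^+ 2.
    have NR : N^*%R = N by apply: geC0_conj; exact: ltW.
    rewrite -[RHS]braket_norm braketBr !braketBl !braketZr !braketZl NR.
    rewrite (braketC y x) !braket_norm -/N -/c normCK.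
    ring.
  by rewrite exprn_ge0.
rewrite pmulr_rge0// subr_ge0 /N /c -exprMn => h.
rewrite (braketC y x) norm_conjC mulrC -ler_sqr// nnegrE// ?mulr_ge0//.
Qed.

End Braket.

(** * Extension of identities from a set to its closure *)

Section Closure.
Context {K : numFieldType} {W : normedModType K}.
Implicit Types (f : W -> K) (S : set W).

Lemma dense_closure S : dense S -> closure S = setT.
Proof.
move=> dS; apply/seteqP; split=> // p _ B.
rewrite nbhsE => -[U [oU Up] UB].
by have [|s [Os Ss]] := dS U _ oU; [exists p | exists s; split=> //; exact: UB].
Qed.

(** If [f u] were nonzero, a point [s] of [S] within [|f u| / C] of [u] would give
    [|f u| = |f (u - s)| < |f u|]. Asking only for compatibility with subtraction covers linear and
    antilinear slots of a braket alike. *)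
Lemma bounded_vanish_closure f (C : K) S :
    {morph f : u v / u - v} -> (forall u, `|f u| <= C * `|u|) ->
  (forall s, S s -> f s = 0) -> forall u, closure S u -> f u = 0.
Proof.
move=> fB fC fS u Su; apply/eqP/negP => /negP fu0.
have C0 : 0 < C.
  have u0 : 0 < `|u|.
    rewrite normr_gt0; apply: contra_neq fu0 => ->.
    by rewrite -[0 in LHS](subrr 0) fB subrr.
  by rewrite -(pmulr_lgt0 _ u0) (lt_le_trans _ (fC u))// normr_gt0.
have e0 : 0 < `|f u| / C by rewrite divr_gt0// normr_gt0.
have [s [Ss /=]] := Su _ (nbhsx_ballx u _ e0).
rewrite -ball_normE /= ltr_pdivlMr// mulrC => us.
have := le_lt_trans (fC (u - s)) us.
by rewrite fB (fS s Ss) subr0 ltxx.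
Qed.

End Closure.

Lemma lin_span_ind (R : realType) (W : lmodType R[i]) (S P : set W) :
    P 0 -> (forall a u v, P u -> P v -> P (a *: u + v)) -> S `<=` P ->
  lin_span S `<=` P.
Proof.
move=> P0 PD SP u [m [c [s [Ss ->]]]].
elim/big_rec: _ => // j v _ Pv; exact/PD/Pv/SP/Ss.
Qed.

(** * Symmetric operators as graphs, and their variance *)

Section Symmetric.
Context {R : realType} {K : hilbertType R}.
Implicit Types (A : operator K) (S : set K) (psi y z : K).

(** Stated on pairs of the graph, so that it makes sense before [A] is known to be single-valued. *)
Definition symmetric_op A : Prop :=
  forall p q, A p -> A q -> braket p.2 q.1 = braket p.1 q.2.

(** The orthogonal complement of [S] is 0: a consequence of density that suffices for
    single-valuedness. *)
Definition total_set S : Prop :=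
  forall z, (forall s, S s -> braket z s = 0) -> z = 0.

Lemma dense_total {S} : dense S -> total_set S.
Proof.
move=> dS z zS; apply/eqP; rewrite -normr_eq0 -sqrf_eq0 -braket_norm; apply/eqP.
apply: (@bounded_vanish_closure _ _ _ `|z| S _ _ zS); last by rewrite dense_closure.
  exact: braketBr.
exact: cauchy_schwarz.
Qed.

Lemma symmetric_op_lin_span A : symmetric_op A -> symmetric_op (lin_span A).
Proof.
move=> symA.
(* Span induction in one variable at a time: first in [p], with [q] a generator, then in [q]. *)
have step q : A q -> lin_span A `<=` [set p | braket p.2 q.1 = braket p.1 q.2].
  move=> Aq; apply: lin_span_ind => /=; first by rewrite !braket0l.
  - by move=> a u v; rewrite !braketDl !braketZl => -> ->.
  - by move=> p Ap; apply: symA.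
move=> p q Sp; move: q.
apply: lin_span_ind => /=; first by rewrite !braket0r.
- by move=> a u v; rewrite !braketDr !braketZr => -> ->.
- by move=> q Aq; apply: step.
Qed.

(** The defect of symmetry [f] is bounded in each argument for the max norm of [K * K], so its
    vanishing passes to the closure in [q], then in [p]. *)
Lemma symmetric_op_closure A : symmetric_op A -> symmetric_op (closure A).
Proof.
pose f (p q : K * K) : R[i] := braket p.2 q.1 - braket p.1 q.2.
have f_le p q : `|f p q| <= (`|p.1| + `|p.2|) * `|q| /\
                `|f p q| <= (`|q.1| + `|q.2|) * `|p|.
  have fst_le (x : K * K) : `|x.1| <= `|x|.
    by rewrite prod_normE/= comparable_le_max ?lexx// real_comparable.
  have snd_le (x : K * K) : `|x.2| <= `|x|.
    by rewrite prod_normE/= comparable_le_max ?lexx ?orbT// real_comparable.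
  have f_le0 : `|f p q| <= `|p.2| * `|q.1| + `|p.1| * `|q.2|.
    by apply: (le_trans (ler_normB _ _)); rewrite lerD// cauchy_schwarz.
  split; apply: (le_trans f_le0).
    by rewrite addrC mulrDl lerD// ler_wpM2l.
  by rewrite mulrDl lerD// mulrC ler_wpM2l.
move=> symA p q Sp Sq; apply/eqP; rewrite -subr_eq0 -/(f p q); apply/eqP.
move: q Sq; apply: bounded_vanish_closure => [u v|q|q Aq].
- by rewrite /f/= !braketBr opprD addrACA -opprD.
- exact: (f_le p q).1.
move: p Sp; apply: (@bounded_vanish_closure _ _ (f^~ q)) => [u v|p|p Ap].
- by rewrite /f/= !braketBl opprD addrACA -opprD.
- exact: (f_le p q).2.
by rewrite /f symA// subrr.
Qed.

(** By symmetry, [y - y'] is orthogonal to the whole domain. *)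
Lemma symmetric_op_inj {A psi y y'} : symmetric_op A -> total_set (op_dom A) ->
  A (psi, y) -> A (psi, y') -> y = y'.
Proof.
move=> symA totA Ay Ay'; apply/eqP; rewrite -subr_eq0; apply/eqP.
apply: totA => s [t Ast].
by rewrite braketBl (symA _ _ Ay Ast) (symA _ _ Ay' Ast) subrr.
Qed.

Lemma op_appP A psi : op_dom A psi -> A (psi, op_app A psi).
Proof. by case=> y Ay; exact: (@xgetPex _ 0 [set y | A (psi, y)] (ex_intro _ y Ay)). Qed.

Lemma op_variance_norm A psi : `|psi| = 1 ->
    braket (op_app A psi) psi = braket psi (op_app A psi) ->
  (op_variance A psi)%:C%C =
    `|op_app A psi - braket psi (op_app A psi) *: psi| ^+ 2.
Proof.
rewrite /op_variance; set v := op_app A psi => psi1 mE; set m := braket psi v.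
(* As the mean [m] is real and [psi] is a unit vector, each cross term of the expanded square
   contributes [- m ^+ 2] and the last term [m ^+ 2]. *)
have mR : m^*%R = m by rewrite -braketC.
suff -> : braket v v - m ^+ 2 = `|v - m *: psi| ^+ 2.
  by rewrite RRe_real// realX.
rewrite -[RHS]braket_norm braketBr !braketBl !braketZr !braketZl mR mE.
rewrite (braket_norm psi) psi1 -/m; ring.
Qed.

End Symmetric.

Lemma normr_sum_sqr_le (C : numClosedFieldType) (W : normedZmodType C) n
    (w : 'I_n -> W) (M : C) :
  0 <= M -> (forall i, `|w i| ^+ 2 <= M) ->
  `|\sum_(i < n) w i| ^+ 2 <= n%:R ^+ 2 * M.
Proof.
move=> M0 wM; rewrite -[M]sqrtCK -exprMn ler_sqr ?nnegrE ?mulr_ge0 ?sqrtC_ge0//.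
apply: (le_trans (ler_norm_sum _ _ _)).
rewrite mulr_natl -[n in leRHS]card_ord -sumr_const; apply: ler_sum => i _.
by rewrite -(@ler_sqr C) ?nnegrE ?sqrtC_ge0// sqrtCK.
Qed.

(** * Simple tensors and local operators *)

Section Tensor.
Context {R : realType} {V K : hilbertType R} {n : nat} {tau : ('I_n -> V) -> K}
  (tauP : hilbert_tensor_power tau).
Implicit Types (x y : 'I_n -> V) (i : 'I_n) (H : operator V).
Local Notation upd x i u := (@dfwith 'I_n (fun=> V) x i u).

Lemma braket_tensor_upd x y i u :
  braket (tau (upd x i u)) (tau y) =
    braket u (y i) * \prod_(j < n | j != i) braket (x j) (y j).
Proof.
have [_ -> _] := tauP; rewrite (bigD1 i)//= dfwithin; congr (_ * _).
by apply: eq_bigr => j ji; rewrite dfwithout// eq_sym.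
Qed.

Lemma norm_tensor_upd x i u :
  `|tau (upd x i u)| = `|u| * \prod_(j < n | j != i) `|x j|.
Proof.
apply/eqP; rewrite -(@eqrXn2 _ 2)// ?mulr_ge0 ?prodr_ge0//; apply/eqP.
rewrite -braket_norm braket_tensor_upd dfwithin braket_norm exprMn -prodrXl.
congr (_ * _); apply: eq_bigr => j ji.
by rewrite dfwithout ?braket_norm// eq_sym.
Qed.

Lemma upd_id x i : upd x i (x i) = x.
Proof. by apply/funext => j; case: dfwithP. Qed.

(** Simple tensors span a dense subspace, so it is enough that [z] is orthogonal to each of them.
    With the other factors fixed, the braket with [z] is bounded in the [i]-th factor and vanishes
    on the dense domain of [H]. *)
Lemma tensor_total {H i} : dense (op_dom H) ->
  total_set [set tau x | x in [set x | op_dom H (x i)]].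
Proof.
move=> dH z z0; have [tau_lin _ dtau] := tauP.
apply: (dense_total dtau); apply: lin_span_ind => /=; first exact: braket0r.
  by move=> a u v zu zv; rewrite braketDr braketZr zu zv mulr0 addr0.
move=> _ [x _ <-]; rewrite -(upd_id x i).
pose C := `|z| * \prod_(j < n | j != i) `|x j|.
apply: (@bounded_vanish_closure _ _ (fun u => braket z (tau (upd x i u))) C
  (op_dom H)); last by rewrite dense_closure.
- move=> u v; rewrite -braketBr; congr (braket z _).
  by have /= := tau_lin x i (-1) v u; rewrite !scaleN1r (addrC (- v)) => ->; rewrite addrC.
- move=> u; apply: (le_trans (cauchy_schwarz _ _)).
  by rewrite norm_tensor_upd /C -mulrA (mulrC (\prod_(j < n | _) _)).
- by move=> u Hu; apply: z0; exists (upd x i u) => //=; rewrite dfwithin.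
Qed.

(** On generators the braket factorises and only its [i]-th factor involves [H]. *)
Lemma local_op_symmetric {H i} : symmetric_op H -> symmetric_op (local_op tau H i).
Proof.
move=> symH; apply/symmetric_op_closure/symmetric_op_lin_span.
move=> _ _ [x [w [Hx ->]]] [y [w' [Hy ->]]] /=.
rewrite braket_tensor_upd (symH _ _ Hx Hy) (braketC (tau _)) braket_tensor_upd.
rewrite rmorphM/= rmorph_prod/= -braketC; congr (_ * _).
by apply: eq_bigr => j _; rewrite -braketC.
Qed.

Lemma local_op_total {H i} : dense (op_dom H) -> total_set (op_dom (local_op tau H i)).
Proof.
move=> dH z z0; apply: (tensor_total (i := i) dH) => _ [x [w Hxw] <-].
apply: z0; exists (tau (upd x i w)); apply: subset_closure.
exists 1%N, (fun=> 1), (fun=> (tau x, tau (upd x i w))).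
by split=> [_|]; [exists x, w | rewrite big_ord1 scale1r].
Qed.

End Tensor.

Theorem mainTheorem1 (R : realType) (V : hilbertType R) (H : operator V)
    (Hsa : self_adjoint H) (Hnd : nondegenerate_spectrum H)
    (n : nat) (n_gt0 : (0 < n)%N)
    (K : hilbertType R) (tau : ('I_n -> V) -> K)
    (Htau : hilbert_tensor_power tau)
    (psi : K) (psi_unit : `|psi| = 1)
    (psi_dom : forall i : 'I_n, op_dom (local_op tau H i) psi) :
  op_variance (collective_op tau H) psi <=
  n%:R ^+ 2 * \big[Num.max/op_variance (local_op tau H (Ordinal n_gt0)) psi]_(i < n)
                op_variance (local_op tau H i) psi.
Proof.
have [dH HE] := Hsa.
have symH : symmetric_op H.
  by move=> p q Hp Hq; rewrite HE in Hq; rewrite braketC -Hq// -braketC.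
pose v i := op_app (local_op tau H i) psi.
have vP i : local_op tau H i (psi, v i) by exact: op_appP.
have symL i := local_op_symmetric Htau (i := i) symH.
have vC i : braket (v i) psi = braket psi (v i) by exact: (symL i _ _ (vP i) (vP i)).
(* Any value of the sum at [psi] is a sum of values [y i] of the local operators, and
   single-valuedness forces [y i = v i]. *)
have vE : op_app (collective_op tau H) psi = \sum_(i < n) v i.
  have [|y [yP /= ->]] := @op_appP _ _ (collective_op tau H) psi.
    by exists (\sum_(i < n) v i), v.
  apply: eq_bigr => i _.
  exact: symmetric_op_inj (symL i) (local_op_total Htau dH) (yP i) (vP i).
have varE i : (op_variance (local_op tau H i) psi)%:C%C =
    `|v i - braket psi (v i) *: psi| ^+ 2 by apply: op_variance_norm => //; exact: vC.
(* The default value is one of the terms, so [M] is their maximum; it is nonnegative because the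
   variances are squared norms. *)
set M := \big[_/_]_(i < n) _.
have leM i : (op_variance (local_op tau H i) psi)%:C%C <= M%:C%C.
  by rewrite lecR; exact: le_bigmax.
(* The inequality is moved to [R[i]], where the norms take their values. The side goal, that the
   collective mean is real, follows by summing [vC]. *)
rewrite -lecR op_variance_norm//; last first.
  rewrite vE braketC !braket_sumr rmorph_sum/=; apply: eq_bigr => i _.
  by rewrite -[LHS]braketC.
rewrite vE braket_sumr scaler_suml -sumrB rmorphM rmorphXn rmorph_nat.
apply: normr_sum_sqr_le => [|i].
  apply: le_trans (leM (Ordinal n_gt0)).
  by rewrite varE exprn_ge0.
by rewrite -varE.
Qed.
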